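(* Let $n\ge 3$ and let $G$ be a triangulated $n$-cycle. Every measurement in $\mathbf{xS}(P)$, viewed as a function on the configuration space $\mathbf A^n$ of all $n$-gons $P$, can be expressed as a Laurent polynomial in the measurements in $\mathbf{xS}_G(P)$, whose denominator is a monomial in the squared lengths of diagonals of $G$. That is, for every measurement $m\in\{x_{ij}\}\cup\{S_{ijk}\}$ ($i,j,k\in\{1,\dots,n\}$ distinct) there exist a polynomial $Q$ with complex coefficients in the measurements of $\mathbf{xS}_G(P)$ and a monomial $M$ in the variables $x_{ab}$, $\{a,b\}$ a diagonal of $G$, such that $m=Q/M$ as rational functions on $\mathbf A^n$.
   Context: $\mathbf A=\mathbb C^2$ is the complex plane, with forms $\langle u,v\rangle=u'v'+u''v''$ and $[u,v]=u'v''-u''v'$ on vectors $u=(u',u'')$, $v=(v',v'')\in\mathbb C^2$. For points put $x(A,B)=\langle\overrightarrow{AB},\overrightarrow{AB}\rangle$ and $S(A,B,C)=2[\overrightarrow{AB},\overrightarrow{AC}]$. An $n$-gon is an ordered $n$-tuple $P=(A_1,\dots,A_n)\in\mathbf A^n$. Its measurements are $x_{ij}=x(A_i,A_j)$ and $S_{ijk}=S(A_i,A_j,A_k)$ for distinct $i,j,k$; $\mathbf{xS}(P)$ denotes the collection of all of them. A triangulated $n$-cycle is a graph $G$ on vertices $1,\dots,n$ consisting of the $n$ sides $\{1,2\},\dots,\{n-1,n\},\{1,n\}$ together with $n-3$ diagonals which triangulate a convex $n$-gon with vertices cyclically labeled $1,\dots,n$. $\mathbf{xS}_G(P)$ is the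 subcollection of measurements consisting of the $x_{ij}$ for edges $\{i,j\}$ of $G$ (sides and diagonals) and the $S_{ijk}$ for triangles $\{i,j,k\}$ of the triangulation $G$. *)

(* Defs.v *)
From mathcomp Require Import all_boot all_order all_algebra.
From mathcomp Require Import reals complex.
From mathcomp Require Import mpoly.

Set Implicit Arguments.
Unset Strict Implicit.
Unset Printing Implicit Defensive.

Import GRing.Theory Num.Theory.

Local Open Scope ring_scope.
Local Open Scope complex_scope.

Definition point (R : realType) : Type := (R[i] * R[i])%type.

Definition dotp (R : realType) (u v : point R) : R[i] :=
  u.1 * v.1 + u.2 * v.2.

Definition bracket (R : realType) (u v : point R) : R[i] :=
  u.1 * v.2 - u.2 * v.1.

Definition vec (R : realType) (A B : point R) : point R :=
  (B.1 - A.1, B.2 - A.2).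

Definition sqdist (R : realType) (A B : point R) : R[i] :=
  dotp (vec A B) (vec A B).

Definition sarea (R : realType) (A B C : point R) : R[i] :=
  2 * bracket (vec A B) (vec A C).

Definition ngon (R : realType) (n : nat) : Type := n.-tuple (point R).

(* Labels of measurements: [inl (i, j)] stands for x_ij and
   [inr (i, j, k)] for S_ijk; vertices are numbered from 0. *)
Definition label (n : nat) := (('I_n * 'I_n) + ('I_n * 'I_n * 'I_n))%type.

Definition is_measurement (n : nat) (m : label n) : bool :=
  match m with
  | inl (i, j) => i != j
  | inr (i, j, k) => uniq [:: i; j; k]
  end.

Definition measurement (R : realType) (n : nat) (P : ngon R n) (m : label n) :
    R[i] :=
  match m with
  | inl (i, j) => sqdist (tnth P i) (tnth P j)
  | inr (i, j, k) => sarea (tnth P i) (tnth P j) (tnth P k)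
  end.

(* A graph on the vertex set 'I_n is given by its set of edges, each edge
   being a two-element subset. [ordS] is the cyclic successor. *)
Definition sides (n : nat) : {set {set 'I_n}} :=
  [set [set i; ordS i] | i : 'I_n].

Definition polygon_diagonals (n : nat) : {set {set 'I_n}} :=
  [set e : {set 'I_n} | #|e| == 2] :\: sides n.

(* In a convex polygon, two diagonals meet in an interior point exactly when
   their endpoints are four distinct vertices that alternate along the
   boundary. *)
Definition crossing (n : nat) (e f : {set 'I_n}) : bool :=
  [exists a : 'I_n, exists b : 'I_n, exists c : 'I_n, exists d : 'I_n,
    [&& (a < b < c)%N, (c < d)%N &
        ((e == [set a; c]) && (f == [set b; d])) ||
        ((f == [set a; c]) && (e == [set b; d]))]].

Definition triangulated_cycle (n : nat) (G : {set {set 'I_n}}) : Prop :=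
  exists D : {set {set 'I_n}},
    [/\ D \subset polygon_diagonals n,
        #|D| = (n - 3)%N,
        {in D &, forall e f, ~~ crossing e f} &
        G = sides n :|: D].

(* Since x_ij = x_ji, and S_ijk is alternating in its indices, each edge and
   each triangle contributes one variable, with increasing indices. *)
Definition xS_labels (n : nat) (G : {set {set 'I_n}}) : {set label n} :=
  [set m : label n |
    match m with
    | inl (i, j) => (i < j)%N && ([set i; j] \in G)
    | inr (i, j, k) =>
        [&& (i < j < k)%N, [set i; j] \in G, [set j; k] \in G &
            [set i; k] \in G]
    end].

Definition diagonal_labels (n : nat) (G : {set {set 'I_n}}) : {set label n} :=
  [set m : label n |
    match m with
    | inl (i, j) => (i < j)%N && ([set i; j] \in G :\: sides n)
    | inr _ => false
    end].

(* The values at P of the measurements in a finite set L of labels, as a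
   valuation of #|L| polynomial variables. *)
Definition values (R : realType) (n : nat) (P : ngon R n)
    (L : {set label n}) : 'I_#|L| -> R[i] :=
  fun l => measurement P (enum_val l).
Arguments values {R n} P L l.

(* Main.v *)
(* Call two vector-valued functions u, v of the polygon related when <u,v> and
   [u,v] are Laurent polynomials of the required kind. Edge vectors of a common
   triangle of G are related, and u ~ v ~ w implies u ~ w whenever v is a
   diagonal, since <u,w><v,v> and [u,w]<v,v> are polynomials in the products of
   u with v and of v with w. Walking through the triangles relates all pairs of
   vectors A_i A_j, and every measurement is a product of two of them.
   The triangles come from counting: an interval [a, b] of vertices contains at
   most b - a - 1 non-crossing chords, and by induction equality forces {a, b}
   to be an edge of G and [a, b] to split at some k into two tight intervals. *)
Require Import Defs.
From mathcomp Require Import all_boot all_order all_algebra.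
From mathcomp Require Import reals complex.
From mathcomp Require Import mpoly.
From mathcomp Require Import zify ring.

Set Implicit Arguments.
Unset Strict Implicit.
Unset Printing Implicit Defensive.

Import GRing.Theory Num.Theory.

Local Open Scope ring_scope.
Local Open Scope complex_scope.

(** * Chords and triangulations of vertex intervals *)

Definition chords_in (n : nat) (D : {set {set 'I_n}}) (a b : 'I_n) :
    {set {set 'I_n}} :=
  [set e in D | e \subset [set x : 'I_n | (a <= x <= b)%N]].

Definition nchords (n : nat) (D : {set {set 'I_n}}) (a b : 'I_n) : nat :=
  #|chords_in D a b|.

(** A binary tree with sides as leaves and triangles as inner nodes. The base of a glued interval
    must lie in [D]; when [D] consists of diagonals, this excludes the side joining the first and
    last vertices, so the whole polygon is treated separately. *)
Inductive interval_triangulation (n : nat) (D : {set {set 'I_n}}) :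
    'I_n -> 'I_n -> Prop :=
| Interval_side (a b : 'I_n) :
    b = a.+1 :> nat -> interval_triangulation D a b
| Interval_glue (a k b : 'I_n) :
    (a < k < b)%N -> [set a; b] \in D -> interval_triangulation D a k ->
    interval_triangulation D k b -> interval_triangulation D a b.

Lemma cards2_ltP (n : nat) (e : {set 'I_n}) :
  #|e| == 2 -> exists i j : 'I_n, (i < j)%N /\ e = [set i; j].
Proof.
case/cards2P=> i [j [neq_ij ->]]; case: (ltngtP i j) => [lt_ij|lt_ji|eq_ij].
- by exists i, j.
- by exists j, i; split=> //; rewrite setUC.
- by case/eqP: neq_ij; apply: val_inj.
Qed.

Lemma side_succ (n : nat) (a b : 'I_n) :
  b = a.+1 :> nat -> [set a; b] \in sides n.
Proof.
move=> eq_b; apply/imsetP; exists a => //; congr [set _; _]; apply: val_inj.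
by rewrite /= modn_small // -eq_b.
Qed.

(** * Counting non-crossing chords *)

Section Counting.
Variables (n : nat) (D : {set {set 'I_n}}).
Hypothesis diagD : D \subset polygon_diagonals n.
Hypothesis ncD : {in D &, forall e f, ~~ crossing e f}.

Lemma chord_ltP (e : {set 'I_n}) : e \in D ->
  exists i j : 'I_n, (i.+1 < j)%N /\ e = [set i; j].
Proof.
move=> /(subsetP diagD); rewrite !inE => /andP[side_e].
move=> /cards2_ltP[i [j [lt_ij eq_e]]]; exists i, j; split=> //.
rewrite ltn_neqAle lt_ij andbT; apply: contra side_e => /eqP eq_ij.
by rewrite eq_e side_succ.
Qed.

(* The apex of the triangle on the base [a, b] is the farthest neighbour k of
   a inside the interval: no chord can pass over k without crossing {a, k}. *)
Lemma chords_in_split (a b : 'I_n) : (a.+1 < b)%N ->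
  exists k : 'I_n, (a < k < b)%N /\
    chords_in D a b \subset
      [set [set a; b]] :|: (chords_in D a k :|: chords_in D k b).
Proof.
move=> lt_ab; have lt_an : (a.+1 < n)%N by apply: ltn_trans lt_ab _.
pose cand (k : 'I_n) :=
  (([set a; k] \in D) || (k == a.+1 :> nat)) && (a < k < b)%N.
have cand0 : cand (Ordinal lt_an) by rewrite /cand /= eqxx orbT ltnSn.
case: (@arg_maxnP _ (Ordinal lt_an) cand (fun k => k : nat) cand0) => k.
case/andP=> near_k /andP[lt_ak lt_kb] max_k.
exists k; rewrite lt_ak; split=> //; apply/subsetP=> e.
rewrite !inE => /andP[eD]; have [i [j [lt_ij eq_e]]] := chord_ltP eD.
rewrite eD eq_e !subUset !sub1set !inE /= => /andP[/andP[ai ib] /andP[aj jb]].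
case: (leqP j k) => [jk|kj].
  by rewrite ai aj (leq_trans (ltnW (ltnW lt_ij)) jk) !orbT.
case: (leqP k i) => [ki|ik].
  by rewrite ib jb (ltnW kj) !orbT.
(* The chord now passes over [k]. If [a < i], either it crosses {a, k} or no vertex is left between
   [a] and [k]. *)
have eq_ia : i = a.
  apply: val_inj => /=; apply/eqP; rewrite eqn_leq ai andbT leqNgt.
  apply/negP=> lt_ai.
  case/orP: near_k => [akD|/eqP eq_k]; last by lia.
  have /negP[] := ncD akD eD.
  apply/existsP; exists a; apply/existsP; exists i.
  apply/existsP; exists k; apply/existsP; exists j.
  by rewrite lt_ai ik kj eq_e !eqxx.
suff -> : j = b by rewrite eq_ia eqxx.
apply: val_inj => /=; apply/eqP; rewrite eqn_leq jb leqNgt; apply/negP=> lt_jb.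
have : cand j by rewrite /cand -eq_ia -eq_e eD; lia.
by move/max_k; lia.
Qed.

(** A split at [k] allows at most 1 + (k - a - 1) + (b - k - 1) = b - a - 1 chords, so equality
    makes all three contributions maximal. *)
Lemma chords_in_bound (a b : 'I_n) : (a < b)%N ->
  (nchords D a b < b - a)%N /\
  ((nchords D a b).+1 = b - a -> interval_triangulation D a b)%N.
Proof.
have [m] := ubnP (b - a)%N; elim: m a b => // m IHm a b le_m lt_ab.
case: (ltnP a.+1 b) => [lt_Sab|le_ba]; last first.
  have eq_b : b = a.+1 :> nat by lia.
  have -> : nchords D a b = 0%N.
    apply/eqP; rewrite cards_eq0; apply/eqP.
    apply/setP=> e; rewrite !inE; apply/negP=> /andP[eD].
    have [i [j [lt_ij ->]]] := chord_ltP eD.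
    by rewrite subUset !sub1set !inE; lia.
  by split; [lia | move=> _; apply: Interval_side].
have [k [/andP[lt_ak lt_kb] sub]] := chords_in_split lt_Sab.
have [|bound_ak tri_ak] := IHm a k _ lt_ak; first by lia.
have [|bound_kb tri_kb] := IHm k b _ lt_kb; first by lia.
have le_ab : (nchords D a b <= 1 + (nchords D a k + nchords D k b))%N.
  apply: leq_trans (subset_leq_card sub) _.
  apply: leq_trans (leq_card_setU _ _).1 _.
  by rewrite cards1 leq_add2l (leq_card_setU _ _).1.
split; first by lia.
move=> tight; apply: (@Interval_glue _ _ a k b).
- by rewrite lt_ak.
(* Without {a, b} the two halves hold every chord, which is one too few for [tight]. *)
- apply/negPn/negP=> abD.
  have : chords_in D a b \subset chords_in D a k :|: chords_in D k b.
    apply/subsetP=> e eab; case/setUP: (subsetP sub e eab) => [/set1P eq_e|//].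
    by move: eab; rewrite inE eq_e (negPf abD).
  move/subset_leq_card/leq_trans/(_ (leq_card_setU _ _).1).
  by rewrite -!/(nchords _ _ _); lia.
- by apply: tri_ak; lia.
- by apply: tri_kb; lia.
Qed.

End Counting.

(** The base {0, n} is a side and adds no chord: the n - 2 diagonals equal the maximum (k - 1) + (n
    - k - 1), so both halves are tight. *)
Lemma triangulated_cycle_apex (n : nat) (D : {set {set 'I_n.+1}}) :
  (1 < n)%N -> D \subset polygon_diagonals n.+1 -> #|D| = (n - 2)%N ->
  {in D &, forall e f, ~~ crossing e f} ->
  exists k : 'I_n.+1, [/\ (0 < k < n)%N, interval_triangulation D ord0 k &
    interval_triangulation D k ord_max].
Proof.
move=> n_gt1 diagD cardD ncD.
have [] := @chords_in_split _ _ diagD ncD ord0 ord_max; first by [].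
move=> k [/andP[k_gt0 lt_kn] sub].
have sub' : D \subset chords_in D ord0 k :|: chords_in D k ord_max.
  apply/subsetP=> e eD; have : e \in chords_in D ord0 ord_max.
    rewrite inE eD; apply/subsetP=> x _.
    by rewrite inE /= -ltnS ltn_ord.
  case/(subsetP sub)/setUP=> [/set1P eq_e|//].
  move/(subsetP diagD): eD; rewrite eq_e inE => /andP[/negP[]].
  (* [ordS] wraps around: {0, n} is the side that starts at the last vertex. *)
  apply/imsetP; exists ord_max => //; rewrite setUC; congr [set _; _].
  by apply: val_inj; rewrite /= modnn.
have le_D : (#|D| <= nchords D ord0 k + nchords D k ord_max)%N.
  exact: leq_trans (subset_leq_card sub') (leq_card_setU _ _).1.
have [bound1 tri1] := @chords_in_bound _ _ diagD ncD ord0 k k_gt0.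
have [bound2 tri2] := @chords_in_bound _ _ diagD ncD k ord_max lt_kn.
rewrite cardD in le_D; rewrite /= in k_gt0 lt_kn bound1 tri1 bound2 tri2.
exists k; split; first by rewrite k_gt0.
- by apply: tri1; lia.
- by apply: tri2; lia.
Qed.

(** * Laurent polynomials in the measurements *)

Section Laurent.
Variables (R : realType) (n : nat) (G : {set {set 'I_n}}).

Definition xS_polynomial (f : ngon R n -> R[i]) : Prop :=
  exists Q : {mpoly R[i][#|xS_labels G|]},
    forall P, f P = Q.@[values P (xS_labels G)].

(** The denominator is cleared, so the identity is required at every polygon, even where the
    monomial vanishes, and no nonvanishing conditions accumulate. *)
Definition xS_laurent (f : ngon R n -> R[i]) : Prop :=
  exists M : 'X_{1..#|diagonal_labels G|},
    xS_polynomial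
      (fun P => f P * 'X_[R[i], M].@[values P (diagonal_labels G)]).

Lemma xS_polynomial_ext (f g : ngon R n -> R[i]) :
  f =1 g -> xS_polynomial f -> xS_polynomial g.
Proof. by move=> eq_fg [Q fQ]; exists Q => P; rewrite -eq_fg. Qed.

Lemma xS_polynomial_const (c : R[i]) : xS_polynomial (fun=> c).
Proof. by exists c%:MP => P; rewrite mevalC. Qed.

Lemma xS_polynomialD (f g : ngon R n -> R[i]) :
  xS_polynomial f -> xS_polynomial g -> xS_polynomial (fun P => f P + g P).
Proof.
by move=> [Q fQ] [S gS]; exists (Q + S) => P; rewrite mevalD fQ gS.
Qed.

Lemma xS_polynomialM (f g : ngon R n -> R[i]) :
  xS_polynomial f -> xS_polynomial g -> xS_polynomial (fun P => f P * g P).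
Proof.
by move=> [Q fQ] [S gS]; exists (Q * S) => P; rewrite mevalM fQ gS.
Qed.

Lemma xS_polynomial_label (l : label n) :
  l \in xS_labels G -> xS_polynomial (fun P => measurement P l).
Proof.
move=> lG; exists 'X_(enum_rank_in lG l) => P.
by rewrite mevalXU /values enum_rankK_in.
Qed.

Lemma diagonal_labels_sub : diagonal_labels G \subset xS_labels G.
Proof.
apply/subsetP=> -[[i j]|[[i j] k]]; rewrite !inE //.
by case/andP=> -> /andP[_ ->].
Qed.

(** Lets each numerator absorb the other denominator when a sum is brought to a common
    denominator. *)
Lemma xS_polynomial_diagonal_monomial (M : 'X_{1..#|diagonal_labels G|}) :
  xS_polynomial (fun P => 'X_[R[i], M].@[values P (diagonal_labels G)]).
Proof.
have polyX (f : ngon R n -> R[i]) (k : nat) :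
    xS_polynomial f -> xS_polynomial (fun P => f P ^+ k).
  by move=> [Q fQ]; exists (Q ^+ k) => P; rewrite rmorphXn /= fQ.
apply: (@xS_polynomial_ext
  (fun P => \prod_(i < #|diagonal_labels G|)
     values P (diagonal_labels G) i ^+ M i)) => [P|].
  by rewrite mevalX.
elim: (index_enum _) => [|i s IHs].
  apply: xS_polynomial_ext (xS_polynomial_const 1) => P.
  by rewrite big_nil.
apply: (@xS_polynomial_ext (fun P => values P (diagonal_labels G) i ^+ M i *
   \prod_(j <- s) values P (diagonal_labels G) j ^+ M j)) => [P|].
  by rewrite big_cons.
apply: xS_polynomialM => //; apply/polyX/xS_polynomial_label.
exact: subsetP diagonal_labels_sub _ (enum_valP i).
Qed.

Lemma xS_laurent_ext (f g : ngon R n -> R[i]) :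
  f =1 g -> xS_laurent f -> xS_laurent g.
Proof.
move=> eq_fg [M polyM]; exists M.
by apply: xS_polynomial_ext polyM => P; rewrite eq_fg.
Qed.

Lemma xS_laurent_poly (f : ngon R n -> R[i]) : xS_polynomial f -> xS_laurent f.
Proof.
move=> polyf; exists 0%MM; apply: xS_polynomial_ext polyf => P.
by rewrite mpolyX0 meval1 mulr1.
Qed.

Lemma xS_laurentD (f g : ngon R n -> R[i]) :
  xS_laurent f -> xS_laurent g -> xS_laurent (fun P => f P + g P).
Proof.
move=> [M polyM] [N polyN]; exists (M + N)%MM.
apply: xS_polynomial_ext (xS_polynomialD
  (xS_polynomialM polyM (xS_polynomial_diagonal_monomial N))
  (xS_polynomialM polyN (xS_polynomial_diagonal_monomial M))) => P.
by rewrite mpolyXD mevalM; ring.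
Qed.

Lemma xS_laurentM (f g : ngon R n -> R[i]) :
  xS_laurent f -> xS_laurent g -> xS_laurent (fun P => f P * g P).
Proof.
move=> [M polyM] [N polyN]; exists (M + N)%MM.
apply: xS_polynomial_ext (xS_polynomialM polyM polyN) => P.
by rewrite mpolyXD mevalM; ring.
Qed.

Lemma xS_laurentZ (c : R[i]) (f : ngon R n -> R[i]) :
  xS_laurent f -> xS_laurent (fun P => c * f P).
Proof.
exact: xS_laurentM (xS_laurent_poly (xS_polynomial_const c)).
Qed.

Lemma xS_laurentB (f g : ngon R n -> R[i]) :
  xS_laurent f -> xS_laurent g -> xS_laurent (fun P => f P - g P).
Proof.
move=> Lf /(xS_laurentZ (-1)) Lg.
by apply: xS_laurent_ext (xS_laurentD Lf Lg) => P; ring.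
Qed.

(** Dividing by the squared length of a diagonal only raises its exponent in the denominator. *)
Lemma xS_laurent_cancel (f : ngon R n -> R[i]) (l : label n) :
  l \in diagonal_labels G -> xS_laurent (fun P => f P * measurement P l) ->
  xS_laurent f.
Proof.
move=> lG [M polyM]; exists (M + U_(enum_rank_in lG l))%MM.
apply: xS_polynomial_ext polyM => P.
by rewrite mpolyXD mevalM mevalXU /values enum_rankK_in //; ring.
Qed.

(** * Related vectors *)

Definition xS_related (u v : ngon R n -> point R) : Prop :=
  xS_laurent (fun P => dotp (u P) (v P)) /\
  xS_laurent (fun P => bracket (u P) (v P)).

Definition edge_vec (i j : 'I_n) (P : ngon R n) : point R :=
  vec (tnth P i) (tnth P j).

Lemma xS_related_sym (u v : ngon R n -> point R) :
  xS_related u v -> xS_related v u.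
Proof.
move=> [Lu Lb]; split.
  by apply: xS_laurent_ext Lu => P; rewrite /dotp; ring.
by apply: xS_laurent_ext (xS_laurentZ (-1) Lb) => P; rewrite /bracket; ring.
Qed.

(** Both products are bilinear, so constant coefficients preserve relatedness to a fixed [u]. *)
Lemma xS_related_lin (a b : R[i]) (u v v' w : ngon R n -> point R) :
  (forall P, w P = (a * (v P).1 + b * (v' P).1, a * (v P).2 + b * (v' P).2)) ->
  xS_related u v -> xS_related u v' -> xS_related u w.
Proof.
move=> eq_w [Lv Bv] [Lv' Bv']; split.
  apply: xS_laurent_ext (xS_laurentD (xS_laurentZ a Lv) (xS_laurentZ b Lv')).
  by move=> P; rewrite eq_w /dotp /=; ring.
apply: xS_laurent_ext (xS_laurentD (xS_laurentZ a Bv) (xS_laurentZ b Bv')).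
by move=> P; rewrite eq_w /bracket /=; ring.
Qed.

Lemma edge_vecC (i j : 'I_n) (u : ngon R n -> point R) :
  xS_related u (edge_vec i j) -> xS_related u (edge_vec j i).
Proof.
move=> rel; apply: (xS_related_lin (a := -1) (b := 0) _ rel rel) => P.
by rewrite /edge_vec /vec /=; congr (_, _); ring.
Qed.

Lemma edge_vecD (i k j : 'I_n) (u : ngon R n -> point R) :
  xS_related u (edge_vec i k) -> xS_related u (edge_vec k j) ->
  xS_related u (edge_vec i j).
Proof.
apply: (xS_related_lin (a := 1) (b := 1)) => P.
by rewrite /edge_vec /vec /=; congr (_, _); ring.
Qed.

(* Writing u and w in the orthogonal basis formed by v and its rotation gives
   <u,w><v,v> = <u,v><v,w> - [u,v][v,w] and
   [u,w]<v,v> = [u,v]<v,w> + <u,v>[v,w]. *)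
Lemma xS_related_trans (a b : 'I_n) (u w : ngon R n -> point R) :
  inl (a, b) \in diagonal_labels G ->
  xS_related u (edge_vec a b) -> xS_related (edge_vec a b) w -> xS_related u w.
Proof.
move=> abG [Luv Buv] [Lvw Bvw]; split; apply: (xS_laurent_cancel abG).
  apply: xS_laurent_ext (xS_laurentB (xS_laurentM Luv Lvw)
    (xS_laurentM Buv Bvw)) => P.
  by rewrite /= /sqdist /edge_vec /dotp /bracket; ring.
apply: xS_laurent_ext (xS_laurentD (xS_laurentM Buv Lvw)
  (xS_laurentM Luv Bvw)) => P.
by rewrite /= /sqdist /edge_vec /dotp /bracket; ring.
Qed.

Lemma xS_related_edge (a b : 'I_n) :
  (a < b)%N -> [set a; b] \in G -> xS_related (edge_vec a b) (edge_vec a b).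
Proof.
move=> lt_ab abG; split.
  apply/xS_laurent_poly/(xS_polynomial_label (l := inl (a, b))).
  by rewrite inE lt_ab.
apply: xS_laurent_ext (xS_laurent_poly (xS_polynomial_const 0)) => P.
by rewrite /bracket; ring.
Qed.

(** The law of cosines x_ab = x_ak + x_kb + 2<ak, kb> gives the dot product; S_akb = 2[ak, ab] =
    2[ak, kb] gives the bracket. *)
Lemma xS_related_triangle (a k b : 'I_n) :
  (a < k < b)%N -> [set a; k] \in G -> [set k; b] \in G -> [set a; b] \in G ->
  xS_related (edge_vec a k) (edge_vec k b).
Proof.
move=> /andP[lt_ak lt_kb] akG kbG abG.
have Lx (i j : 'I_n) : (i < j)%N -> [set i; j] \in G ->
    xS_laurent (fun P => measurement P (inl (i, j))).
  move=> lt_ij ijG; apply/xS_laurent_poly/xS_polynomial_label.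
  by rewrite inE lt_ij.
have LS : xS_laurent (fun P => measurement P (inr (a, k, b))).
  by apply/xS_laurent_poly/xS_polynomial_label; rewrite inE lt_ak lt_kb akG kbG.
split.
  apply: xS_laurent_ext (xS_laurentZ 2^-1
    (xS_laurentB (xS_laurentB (Lx a b (ltn_trans lt_ak lt_kb) abG)
      (Lx a k lt_ak akG)) (Lx k b lt_kb kbG))) => P.
  by rewrite /= /sqdist /edge_vec /dotp /vec /=; field.
apply: xS_laurent_ext (xS_laurentZ 2^-1 LS) => P.
by rewrite /= /sarea /edge_vec /bracket /vec /=; field.
Qed.

End Laurent.

(** * Propagation through triangulated intervals *)

Section Intervals.
Variables (R : realType) (n : nat) (D : {set {set 'I_n}}).
Hypothesis diagD : D \subset polygon_diagonals n.
Let G := sides n :|: D.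

Definition interval_related (a b : 'I_n) : Prop :=
  forall i j k l : 'I_n, (a <= i <= b)%N -> (a <= j <= b)%N ->
    (a <= k <= b)%N -> (a <= l <= b)%N ->
    xS_related G (@edge_vec R n i j) (edge_vec k l).

Lemma interval_triangulation_lt (a b : 'I_n) :
  interval_triangulation D a b -> (a < b)%N.
Proof.
case=> {a b} [a b -> //|a k b /andP[lt_ak lt_kb] _ _ _].
exact: ltn_trans lt_kb.
Qed.

Lemma interval_triangulation_base (a b : 'I_n) :
  interval_triangulation D a b -> b = a.+1 :> nat \/ [set a; b] \in D.
Proof. by case=> {a b} [a b ->|a k b _ abD _ _]; [left|right]. Qed.

Lemma interval_triangulation_edge (a b : 'I_n) :
  interval_triangulation D a b -> [set a; b] \in G.
Proof.
case/interval_triangulation_base=> [/side_succ abS|abD]; rewrite inE.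
  by rewrite abS.
by rewrite abD orbT.
Qed.

(** Between consecutive vertices the only vectors are zero and plus or minus the side. *)
Lemma xS_related_side (a b i j : 'I_n) (u : ngon R n -> point R) :
  b = a.+1 :> nat -> (a <= i <= b)%N -> (a <= j <= b)%N ->
  xS_related G u (edge_vec a b) -> xS_related G u (edge_vec i j).
Proof.
move=> eq_b i_ab j_ab rel_u; have rel_u' := edge_vecC rel_u.
have ends (x : 'I_n) : (a <= x <= b)%N -> x = a \/ x = b.
  move=> x_ab; case: (eqVneq (x : nat) a) => [/val_inj|neq_xa]; first by left.
  by right; apply: val_inj => /=; lia.
have [-> | ->] := ends i i_ab; have [-> | ->] := ends j j_ab => //.
  exact: edge_vecD rel_u rel_u'.
exact: edge_vecD rel_u' rel_u.
Qed.

(** A diagonal base allows transitivity. A side may not be divided by, but then every vector in the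
    interval is a multiple of it. *)
Lemma xS_related_base (a b i j : 'I_n) (w : ngon R n -> point R) :
  interval_triangulation D a b -> interval_related a b ->
  (a <= i <= b)%N -> (a <= j <= b)%N ->
  xS_related G (edge_vec a b) w -> xS_related G (edge_vec i j) w.
Proof.
move=> tri_ab rel_ab i_ab j_ab rel_w.
have lt_ab := interval_triangulation_lt tri_ab.
case: (interval_triangulation_base tri_ab) => [eq_b|abD].
  exact/xS_related_sym/(xS_related_side eq_b)/xS_related_sym.
apply: (xS_related_trans _ _ rel_w); last by apply: rel_ab => //; lia.
rewrite inE lt_ab in_setD in_setU abD orbT andbT /=.
by move/(subsetP diagD): abD; rewrite in_setD => /andP[].
Qed.

(** Asking for {a, b} in [G] rather than in [D] also covers the base of the whole polygon, which is
    a side. *)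
Lemma interval_related_glue (a k b : 'I_n) :
  [set a; b] \in G ->
  interval_triangulation D a k -> interval_triangulation D k b ->
  interval_related a k -> interval_related k b -> interval_related a b.
Proof.
move=> abG tri_ak tri_kb rel_ak rel_kb.
have lt_ak := interval_triangulation_lt tri_ak.
have lt_kb := interval_triangulation_lt tri_kb.
(* The triangle relates ak to kb; changing each vector within its half relates ki to kj. *)
have cross (i j : 'I_n) : (a <= i <= k)%N -> (k <= j <= b)%N ->
    xS_related G (@edge_vec R n k i) (edge_vec k j).
  move=> i_ak j_kb; apply: (xS_related_base tri_ak rel_ak) => //; first by lia.
  apply/xS_related_sym/(xS_related_base tri_kb rel_kb) => //; first by lia.
  apply/xS_related_sym/xS_related_triangle => //; first by rewrite lt_ak.
    exact: interval_triangulation_edge.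
  exact: interval_triangulation_edge.
have star (i j : 'I_n) : (a <= i <= b)%N -> (a <= j <= b)%N ->
    xS_related G (@edge_vec R n k i) (edge_vec k j).
  move=> i_ab j_ab.
  case: (leqP i k) => ik; case: (leqP j k) => jk.
  - by apply: rel_ak; lia.
  - by apply: cross; lia.
  - by apply/xS_related_sym/cross; lia.
  - by apply: rel_kb; lia.
(* Every vector is a difference of vectors from the apex: ij = kj - ki. *)
have spread (u : ngon R n -> point R) (i j : 'I_n) :
    xS_related G u (edge_vec k i) -> xS_related G u (edge_vec k j) ->
    xS_related G u (edge_vec i j).
  by move=> rel_i; apply/edge_vecD/edge_vecC.
move=> i j x y i_ab j_ab x_ab y_ab.
by apply: (spread); apply/xS_related_sym/(spread); apply: star.
Qed.

Lemma interval_triangulation_related (a b : 'I_n) :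
  interval_triangulation D a b -> interval_related a b.
Proof.
elim=> {a b} [a b eq_b|a k b _ abD tri_ak rel_ak tri_kb rel_kb]; last first.
  apply: interval_related_glue tri_ak tri_kb rel_ak rel_kb.
  by rewrite inE abD orbT.
have lt_ab : (a < b)%N by rewrite eq_b.
have abG : [set a; b] \in G by rewrite inE side_succ.
have rel_ab := xS_related_edge R lt_ab abG.
move=> i j k l i_ab j_ab k_ab l_ab.
apply: (xS_related_side eq_b) => //.
exact/xS_related_sym/(xS_related_side eq_b).
Qed.

End Intervals.

(** * The whole polygon *)

Lemma triangulated_cycle_related (R : realType) (n : nat)
    (G : {set {set 'I_n}}) (i j k l : 'I_n) :
  (3 <= n)%N -> triangulated_cycle G ->
  xS_related G (@edge_vec R n i j) (edge_vec k l).
Proof.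
case: n G i j k l => [//|n] G i j k l n_gt1 [D [diagD cardD ncD ->]].
have [|a [_ tri_0a tri_an]] := triangulated_cycle_apex n_gt1 diagD _ ncD.
  by rewrite cardD subSS.
have relI := @interval_triangulation_related R _ _ diagD.
have all (x : 'I_n.+1) : (@ord0 n <= x <= @ord_max n)%N.
  by rewrite /= -ltnS ltn_ord.
apply: (@interval_related_glue R _ _ diagD ord0 a ord_max) => //; last 2 first.
- exact: relI.
- exact: relI.
rewrite in_setU; apply/orP; left; apply/imsetP; exists ord_max => //.
by rewrite setUC; congr [set _; _]; apply: val_inj; rewrite /= modnn.
Qed.

Theorem theorem4p1 (R : realType) (n : nat) (hn : (3 <= n)%N)
    (G : {set {set 'I_n}}) (hG : triangulated_cycle G)
    (m : label n) (hm : is_measurement m) :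
  exists (Q : {mpoly R[i][#|xS_labels G|]})
         (M : 'X_{1..#|diagonal_labels G|}),
    forall P : ngon R n,
      'X_[R[i], M].@[values P (diagonal_labels G)] != 0 ->
      measurement P m =
        Q.@[values P (xS_labels G)] /
        'X_[R[i], M].@[values P (diagonal_labels G)].
Proof.
have [M [Q eq_Q]] : xS_laurent G (fun P : ngon R n => measurement P m).
  (* Here x_ij = <ij, ij> and S_ijk = 2[ij, ik]. *)
  case: m {hm} => [[i j]|[[i j] k]].
    exact: (triangulated_cycle_related R i j i j hn hG).1.
  have [_ rel] := triangulated_cycle_related R i j i k hn hG.
  by apply: xS_laurent_ext (xS_laurentZ 2 rel) => P.
by exists Q, M => P M_neq0; rewrite -eq_Q mulfK.
Qed.
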